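(* Fix $(\alpha_0,T_0)$ with $0<\alpha_0<1$, $T_0>0$. In the $(\alpha,T)$-plane ($0<\alpha<1$, $T>0$), the thermodynamic part of the Hugoniot locus of $(\alpha_0,T_0)$, i.e. the set of $(\alpha,T)$ satisfying $$T\left[4(1+\alpha)+\frac{1-\alpha_0^2}{1-\alpha}\left(\frac{\alpha}{\alpha_0}\right)^2\left(\frac{T_0}{T}\right)^{\frac52}e^{-\frac{T_{\rm i}}{T_0}+\frac{T_{\rm i}}{T}}+2\frac{T_{\rm i}}{T}\alpha\right]=T_0\left[4(1+\alpha_0)+\frac{1-\alpha^2}{1-\alpha_0}\left(\frac{\alpha_0}{\alpha}\right)^2\left(\frac{T}{T_0}\right)^{\frac52}e^{-\frac{T_{\rm i}}{T}+\frac{T_{\rm i}}{T_0}}+2\frac{T_{\rm i}}{T_0}\alpha_0\right],$$ is the graph of a strictly increasing function $T=T(\alpha)$, $\alpha\in(0,1)$. Moreover, $$\lim_{\alpha\to0}T(\alpha)=0,\qquad \lim_{\alpha\to1}T(\alpha)=\infty.$$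
   Context: $T_{\rm i}>0$ is a fixed constant (ionization temperature). The displayed equation is the relation $e-e_0+\frac12(p+p_0)(v-v_0)=0$ for an ionized gas, in which (with constants $a^2,\kappa>0$) $p=\frac1\kappa\frac{1-\alpha^2}{\alpha^2}T^{5/2}e^{-T_{\rm i}/T}$, $v=a^2(1+\alpha)T/p$, $e=a^2\left[\frac32(1+\alpha)T+T_{\rm i}\alpha\right]$, and the subscript $0$ denotes evaluation at $(\alpha_0,T_0)$. *)

(* Defs.v *)
From Stdlib Require Import Reals.
From Coquelicot Require Import Coquelicot.

Open Scope R_scope.

(** This is [(2 / a^2) * (e - e0 + (p + p0) * (v - v0) / 2) = 0] for
    [p = (1 / kappa) * ((1 - alpha^2) / alpha^2) * T^(5/2) * exp (- Ti / T)],
    [v = a^2 * (1 + alpha) * T / p] and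
    [e = a^2 * ((3/2) * (1 + alpha) * T + Ti * alpha)]; the constants [a], [kappa] cancel. *)
Definition hugoniot_eq (Ti alpha0 T0 alpha T : R) : Prop :=
  T * (4 * (1 + alpha)
       + (1 - alpha0 ^ 2) / (1 - alpha) * (alpha / alpha0) ^ 2
         * Rpower (T0 / T) (5 / 2) * exp (- Ti / T0 + Ti / T)
       + 2 * (Ti / T) * alpha)
  = T0 * (4 * (1 + alpha0)
       + (1 - alpha ^ 2) / (1 - alpha0) * (alpha0 / alpha) ^ 2
         * Rpower (T / T0) (5 / 2) * exp (- Ti / T + Ti / T0)
       + 2 * (Ti / T0) * alpha0).

Definition thermo_hugoniot_locus (Ti alpha0 T0 alpha T : R) : Prop :=
  0 < alpha < 1 /\ 0 < T /\ hugoniot_eq Ti alpha0 T0 alpha T.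

(* Main.v *)
Require Import Defs.
From Stdlib Require Import Reals Lra Lia Psatz ClassicalEpsilon.
From Coquelicot Require Import Coquelicot.

Open Scope R_scope.

(** Write [u = sqrt (T / T0)], [th = Ti / T0] and let [p] be the pressure divided by its
    value at [(alpha0, T0)]. Since [(1 - a0^2) / (1 - a) * (a / a0)^2 * ...] is [(1 + a) / p],
    the locus is the zero set of
      [G (a, u) = (1 + a) u^2 (4 + 1/p) - (1 + a0) (4 + p) + 2 th (a - a0)],
      [p = k(a) u^5 exp (th (1 - 1/u^2))],
    where [k] is positive and decreasing.

    At fixed [u], [G] increases with [a], because [p] decreases; this is
    [hugoniot_gap_incr]. At fixed [a], [G] is not monotone in [u], but it can only cross zero
    downwards: if [G (a, x) = 0] and [x < y] then [G (a, y) < 0]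
    ([hugoniot_gap_neg_after_zero]). These two facts make the zero at a given [a] unique and
    force it to increase with [a].

    The downward crossing is where the argument lies. Passing from [x] to [y = s x]
    multiplies [p] by [s^5 e], with [e = exp (th (1/x^2 - 1/y^2)) > 1]. Eliminating [1 + a0]
    by means of [G (a, x) = 0], what has to be shown splits into an inequality in [s] and [p]
    alone, [chord_inequality], which expresses the effect of the factor [s^5], and a
    remainder in [th (a - a0)] and [e - 1]. The remainder has the right sign if
    [a >= a0]; if [a < a0] and [y <= 1], the bound [e >= 1 + th (1/x^2 - 1/y^2)]
    compensates the negative term. In the remaining case [a < a0], [y > 1], monotonicity in
    [a] gives [G (a, y) < G (a0, y)], and the latter is negative because [G (a0, 1) = 0].

    The intermediate value theorem in [u] gives a temperature for every ionization degree
    ([exists_temperature]), and in [a] an ionization degree for every temperature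
    ([exists_ionization]). So [T] is an increasing bijection from the interval from 0 to 1
    onto the positive reals, and both limits follow from surjectivity. *)

(** * The crossing inequality *)

(** The polynomial vanishes to third order at [w = 1], and all its coefficients in powers of
    [w - 1] from the third on are positive. *)
Lemma diagonal_polynomial_pos (w : R) :
  1 < w -> 0 < w^16 + 8*w^11 - 16*w^10 + 16*w^6 - 8*w^5 - 1.
Proof.
intros Hw.
set (h := w - 1).
assert (Hh : 0 < h) by (unfold h; lra).
replace w with (1 + h) by (unfold h; ring).
assert (Hpos : forall n, 0 < h ^ n) by (intros n; now apply pow_lt).
ring_simplify.
pose proof (Hpos 3%nat); pose proof (Hpos 4%nat); pose proof (Hpos 5%nat);
pose proof (Hpos 6%nat); pose proof (Hpos 7%nat); pose proof (Hpos 8%nat);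
pose proof (Hpos 9%nat); pose proof (Hpos 10%nat); pose proof (Hpos 11%nat);
pose proof (Hpos 12%nat); pose proof (Hpos 13%nat); pose proof (Hpos 14%nat);
pose proof (Hpos 15%nat); pose proof (Hpos 16%nat).
lra.
Qed.

(** After clearing denominators the inequality is quadratic in [p], with leading and constant
    terms [4 (s^3 - 1) s^5] and [4 (s^3 - 1)]. Their contributions add up to at least twice
    their geometric mean, [8 (s^3 - 1) s^(5/2) p]; after division by [p], this leaves
    [diagonal_polynomial_pos] in the square root [w] of [s]. *)
Lemma chord_inequality (s p : R) :
  1 < s -> 0 < p ->
  4 * (s^2 - 1) < (1 - 1 / s^3) / p + (4*p + 1) / (4 + p) * (s^5 - 1).
Proof.
intros Hs Hp.
set (w := sqrt s).
assert (Hw : 1 < w) by (unfold w; rewrite <- sqrt_1; apply sqrt_lt_1; lra).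
assert (Hsw : s = w^2) by (unfold w; rewrite pow2_sqrt; lra).
clearbody w; subst s.
assert (Hw3 : 0 < w^6 - 1) by (assert (1 < w^6) by (apply Rlt_pow_R1; [lra | lia]); lra).
assert (Hnum : 0 < 4*(w^6 - 1)*(w^10*p^2 + 1)
                   + p*(w^16 - 1 - 16*w^10 + 16*w^6)).
{ assert (Hsq : 0 <= 4*(w^6 - 1)*(w^5*p - 1)^2)
    by (apply Rmult_le_pos; [lra | apply pow2_ge_0]).
  pose proof (Rmult_lt_0_compat _ _ Hp (diagonal_polynomial_pos w Hw)).
  nra. }
assert (Hden : 0 < p * (4 + p) * w^6)
  by (repeat apply Rmult_lt_0_compat; try lra; apply pow_lt; lra).
apply Rlt_0_minus.
replace (_ - _) with ((4*(w^6 - 1)*(w^10*p^2 + 1)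
                   + p*(w^16 - 1 - 16*w^10 + 16*w^6)) / (p * (4 + p) * w^6))
  by (field; lra).
now apply Rdiv_lt_0_compat.
Qed.

(** Here [A] and [A0] stand for [(1 + a) x^2] and [1 + a0], and [c] for the ionization energy
    [2 th (a - a0)]. The last hypothesis is what remains of the conclusion once [A0] has been
    eliminated by the balance and [chord_inequality] has absorbed the terms without [c] and
    [e - 1]. *)
Lemma heating_breaks_balance (A A0 p c s e : R) :
  0 < A -> 0 < A0 -> 0 < p -> 1 < s -> 1 <= e ->
  A * (4 + 1 / p) + c = A0 * (4 + p) ->
  - c * (s^5 - 1) <= A0 * s^5 * (e - 1) * (4 + p) ->
  A * s^2 * (4 + 1 / (p * (s^5 * e))) + c < A0 * (4 + p * (s^5 * e)).
Proof.
intros HA HA0 Hp Hs He Hbal Hc.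
assert (Hs3 : 0 < s^3) by (apply pow_lt; lra).
assert (Hs5 : 0 < s^5) by (apply pow_lt; lra).
assert (H1 : A * (4 * (s^2 - 1)) < A * ((1 - 1 / s^3) / p + (4*p + 1) / (4 + p) * (s^5 - 1)))
  by (apply Rmult_lt_compat_l; [lra | now apply chord_inequality]).
assert (H2 : A * s^2 * (1 / (p * (s^5 * e))) <= A * s^2 * (1 / (p * s^5))).
{ apply Rmult_le_compat_l; [nra |].
  unfold Rdiv; rewrite !Rmult_1_l.
  apply Rinv_le_contravar; [nra |].
  apply Rmult_le_compat_l; [lra | nra]. }
assert (H3 : 0 <= c * (s^5 - 1) * p / (4 + p) + A0 * p * s^5 * (e - 1)).
{ replace (_ + _) with ((A0 * s^5 * (e - 1) * (4 + p) - - c * (s^5 - 1)) * (p / (4 + p)))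
    by (field; lra).
  apply Rmult_le_pos; [lra |].
  apply Rlt_le, Rdiv_lt_0_compat; lra. }
assert (H4 : A0 = (A * (4 + 1 / p) + c) / (4 + p)) by (rewrite Hbal; field; lra).
(* The balance is used for the factor [s^5] only: the part of [A0] multiplying [e - 1] stays. *)
assert (H5 : A0 * p * (s^5 - 1)
             = A * ((4*p + 1) / (4 + p) * (s^5 - 1)) + c * (s^5 - 1) * p / (4 + p))
  by (rewrite H4; field; lra).
assert (H6 : A * s^2 * (1 / (p * s^5)) = A * (1 / p) - A * ((1 - 1 / s^3) / p))
  by (field; lra).
nra.
Qed.

(** * The Hugoniot function in normalized variables *)

(** At a fixed temperature, Saha's law makes the pressure proportional to [(1 - a^2) / a^2];
    the other factor normalizes it to 1 at [a = a0]. *)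
Definition saha_ratio (a0 a : R) : R := (1 - a^2) / a^2 * (a0^2 / (1 - a0^2)).

(** [u] is the square root of [T / T0], which makes the exponent 5/2 an integer power. *)
Definition pressure_ratio (th a0 a u : R) : R :=
  saha_ratio a0 a * u^5 * exp (th * (1 - 1 / u^2)).

(** The difference of the two sides of the Hugoniot relation, divided by [T0]. *)
Definition hugoniot_gap (th a0 a u : R) : R :=
  (1 + a) * u^2 * (4 + 1 / pressure_ratio th a0 a u)
  - (1 + a0) * (4 + pressure_ratio th a0 a u) + 2 * th * (a - a0).

Lemma saha_ratio_pos (a0 a : R) : 0 < a0 < 1 -> 0 < a < 1 -> 0 < saha_ratio a0 a.
Proof.
intros H0 H; unfold saha_ratio.
apply Rmult_lt_0_compat; apply Rdiv_lt_0_compat; nra.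
Qed.

Lemma saha_ratio_decr (a0 a b : R) :
  0 < a0 < 1 -> 0 < a -> a < b -> b < 1 -> saha_ratio a0 b < saha_ratio a0 a.
Proof.
intros H0 Ha Hab Hb; unfold saha_ratio.
apply Rmult_lt_compat_r; [apply Rdiv_lt_0_compat; nra |].
replace ((1 - b^2) / b^2) with (/ b^2 - 1) by (field; lra).
replace ((1 - a^2) / a^2) with (/ a^2 - 1) by (field; lra).
assert (Ha2 : 0 < a^2) by (apply pow_lt; lra).
assert (Hab2 : a^2 < b^2) by nra.
assert (/ b^2 < / a^2); [apply Rinv_lt_contravar; [nra | assumption] | lra].
Qed.

Lemma pressure_ratio_pos (th a0 a u : R) :
  0 < a0 < 1 -> 0 < a < 1 -> 0 < u -> 0 < pressure_ratio th a0 a u.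
Proof.
intros H0 H Hu; unfold pressure_ratio.
apply Rmult_lt_0_compat; [apply Rmult_lt_0_compat | apply exp_pos];
  [now apply saha_ratio_pos | now apply pow_lt].
Qed.

Lemma hugoniot_gap_incr (th a0 a b u : R) :
  0 < th -> 0 < a0 < 1 -> 0 < u -> 0 < a -> a < b -> b < 1 ->
  hugoniot_gap th a0 a u < hugoniot_gap th a0 b u.
Proof.
intros Hth H0 Hu Ha Hab Hb; unfold hugoniot_gap.
assert (Hpb : 0 < pressure_ratio th a0 b u) by (apply pressure_ratio_pos; lra).
assert (Hlt : pressure_ratio th a0 b u < pressure_ratio th a0 a u).
{ unfold pressure_ratio.
  apply Rmult_lt_compat_r; [apply exp_pos |].
  apply Rmult_lt_compat_r; [now apply pow_lt |].
  now apply saha_ratio_decr. }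
set (q := pressure_ratio th a0 b u) in *.
set (p := pressure_ratio th a0 a u) in *.
assert (Hinv : 1 / p < 1 / q)
  by (unfold Rdiv; rewrite !Rmult_1_l; apply Rinv_lt_contravar; nra).
assert (Hp : 0 < 1 / p) by (apply Rdiv_lt_0_compat; lra).
assert (Hu2 : 0 < u^2) by (now apply pow_lt).
assert ((1 + a) * u^2 * (4 + 1 / p) < (1 + b) * u^2 * (4 + 1 / q)).
{ apply Rmult_gt_0_lt_compat; nra. }
assert ((1 + a0) * (4 + q) < (1 + a0) * (4 + p)) by (apply Rmult_lt_compat_l; lra).
assert (2 * th * (a - a0) < 2 * th * (b - a0)) by (apply Rmult_lt_compat_l; lra).
lra.
Qed.

Lemma pressure_ratio_scale (th a0 a x y : R) :
  0 < x -> 0 < y ->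
  pressure_ratio th a0 a y
  = pressure_ratio th a0 a x * ((y / x)^5 * exp (th * (1 / x^2 - 1 / y^2))).
Proof.
intros Hx Hy; unfold pressure_ratio.
replace (th * (1 - 1 / y^2)) with (th * (1 - 1 / x^2) + th * (1 / x^2 - 1 / y^2)) by ring.
rewrite exp_plus; field; lra.
Qed.

(** * Uniqueness and monotonicity *)

(** When [a0 <= a], the ionization term is nonnegative and [heating_breaks_balance] applies
    at once. When [a < a0], that term is negative but at most [2 th a0] in size, while the
    exponential gains at least [th (s^2 - 1) / y^2], which is at least [th (s^2 - 1)]
    for [y <= 1]. The comparison then reduces to [s^5 - 1 <= 4 s^5 (s^2 - 1)]. *)
Lemma hugoniot_gap_neg_after_zero_same_side (th a0 a x y : R) :
  0 < th -> 0 < a0 < 1 -> 0 < a < 1 -> 0 < x -> x < y ->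
  a0 <= a \/ y <= 1 ->
  hugoniot_gap th a0 a x = 0 -> hugoniot_gap th a0 a y < 0.
Proof.
intros Hth H0 Ha Hx Hxy Hcase Hz.
unfold hugoniot_gap in *.
rewrite (pressure_ratio_scale th a0 a x y) by lra.
pose proof (pressure_ratio_pos th a0 a x H0 Ha Hx) as Hp.
set (p := pressure_ratio th a0 a x) in *; clearbody p.
set (s := y / x).
assert (Hy : y = s * x) by (unfold s; field; lra).
assert (Hs : 1 < s) by (apply Rmult_lt_reg_r with x; lra).
assert (Hs5 : 1 < s^5) by (apply Rlt_pow_R1; [lra | lia]).
set (z := th * (1 / x^2 - 1 / y^2)).
assert (Hzs : z * y^2 = th * (s^2 - 1)) by (unfold z; rewrite Hy; field; lra).
assert (Hz0 : 0 < z).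
{ apply Rmult_lt_reg_r with (y^2); [apply pow_lt; lra |].
  rewrite Hzs, Rmult_0_l; apply Rmult_lt_0_compat; nra. }
assert (He : 1 + z < exp z) by (apply exp_ineq1; lra).
assert (Hbal := heating_breaks_balance ((1 + a) * x^2) (1 + a0) p (2 * th * (a - a0)) s (exp z)).
replace ((1 + a) * y^2) with ((1 + a) * x^2 * s^2) by (rewrite Hy; ring).
cut ((1 + a) * x ^ 2 * s ^ 2 * (4 + 1 / (p * (s ^ 5 * exp z))) + 2 * th * (a - a0) <
       (1 + a0) * (4 + p * (s ^ 5 * exp z))); [lra |].
apply Hbal; try lra.
{ apply Rmult_lt_0_compat; [lra | now apply pow_lt]. }
assert (Hr : 0 <= (1 + a0) * s^5) by (apply Rmult_le_pos; lra).
destruct Hcase as [Hc | Hc].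
{ apply Rle_trans with 0.
  - assert (0 <= 2 * th * (a - a0)) by (apply Rmult_le_pos; lra).
    rewrite Ropp_mult_distr_l_reverse; apply Rge_le, Ropp_0_le_ge_contravar.
    apply Rmult_le_pos; lra.
  - apply Rmult_le_pos; [apply Rmult_le_pos |]; lra. }
assert (Hy1 : y^2 <= 1) by (rewrite <- (pow1 2); apply pow_incr; lra).
assert (Hzl : th * (s^2 - 1) <= z) by (rewrite <- Hzs; nra).
assert (Hq : 0 <= th * (s^2 - 1)) by (apply Rmult_le_pos; nra).
apply Rle_trans with ((1 + a0) * s^5 * (th * (s^2 - 1)) * 4).
2:{ apply Rmult_le_compat; try lra; [now apply Rmult_le_pos |].
    apply Rmult_le_compat_l; lra. }
assert (Hpoly : s^5 - 1 <= 4 * s^5 * (s^2 - 1)).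
{ assert (0 <= s^5 * (s^2 - 1) * 4 - (s^5 - 1)); [| lra].
  replace (s^5 * (s^2 - 1) * 4 - (s^5 - 1))
    with ((s - 1) * (4*s^5*(s+1) - (s^4 + s^3 + s^2 + s + 1))) by ring.
  apply Rmult_le_pos; [lra |].
  assert (s <= s^5 /\ s^2 <= s^5 /\ s^3 <= s^5 /\ s^4 <= s^5) as (k1 & k2 & k3 & k4).
  { repeat split; [rewrite <- (pow_1 s) at 1 | | |]; apply Rle_pow; try lra; lia. }
  nra. }
apply Rle_trans with (th * (1 + a0) * (s^5 - 1)).
{ replace (- (2 * th * (a - a0)) * (s^5 - 1)) with (th * (2 * (a0 - a)) * (s^5 - 1)) by ring.
  apply Rmult_le_compat_r; [lra |]. apply Rmult_le_compat_l; lra. }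
replace ((1 + a0) * s ^ 5 * (th * (s ^ 2 - 1)) * 4)
  with (th * (1 + a0) * (4 * s^5 * (s^2 - 1))) by ring.
apply Rmult_le_compat_l; [apply Rmult_le_pos; lra | exact Hpoly].
Qed.

Lemma hugoniot_gap_base (th a0 : R) : 0 < a0 < 1 -> hugoniot_gap th a0 a0 1 = 0.
Proof.
intros H0; unfold hugoniot_gap.
replace (pressure_ratio th a0 a0 1) with 1; [field |].
unfold pressure_ratio, saha_ratio.
replace (th * (1 - 1 / 1^2)) with 0 by field.
rewrite exp_0; field; nra.
Qed.

(** The case [a < a0], [1 < y] is reached by comparison with the line [a = a0], on which the
    zero is at [1]. *)
Lemma hugoniot_gap_neg_after_zero (th a0 a x y : R) :
  0 < th -> 0 < a0 < 1 -> 0 < a < 1 -> 0 < x -> x < y ->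
  hugoniot_gap th a0 a x = 0 -> hugoniot_gap th a0 a y < 0.
Proof.
intros Hth H0 Ha Hx Hxy Hz.
destruct (Rle_lt_dec a0 a) as [Hc | Hc].
{ apply (hugoniot_gap_neg_after_zero_same_side th a0 a x y); auto. }
destruct (Rle_lt_dec y 1) as [Hy | Hy].
{ apply (hugoniot_gap_neg_after_zero_same_side th a0 a x y); auto. }
apply Rlt_trans with (hugoniot_gap th a0 a0 y).
- apply hugoniot_gap_incr; lra.
- apply (hugoniot_gap_neg_after_zero_same_side th a0 a0 1 y); try lra.
  now apply hugoniot_gap_base.
Qed.

(** If the zero at the larger [b] were below the one at [a], then [G (b, x) < 0] by the downward
    crossing, against [G (b, x) > G (a, x) = 0]; the same inequality excludes equality. *)
Lemma hugoniot_zero_order (th a0 a b x y : R) :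
  0 < th -> 0 < a0 < 1 -> 0 < a < 1 -> 0 < b < 1 -> 0 < x -> 0 < y ->
  hugoniot_gap th a0 a x = 0 -> hugoniot_gap th a0 b y = 0 -> a < b -> x < y.
Proof.
intros Hth H0 Ha Hb Hx Hy Hax Hby Hab.
destruct (Rlt_le_dec x y) as [| Hle]; [assumption | exfalso].
assert (Hinc := hugoniot_gap_incr th a0 a b x Hth H0 Hx (proj1 Ha) Hab (proj2 Hb)).
destruct (Rle_lt_or_eq_dec _ _ Hle) as [Hlt | ->]; [| lra].
assert (Hneg := hugoniot_gap_neg_after_zero th a0 b y x Hth H0 Hb Hy Hlt Hby); lra.
Qed.

Lemma hugoniot_zero_unique (th a0 a x y : R) :
  0 < th -> 0 < a0 < 1 -> 0 < a < 1 -> 0 < x -> 0 < y ->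
  hugoniot_gap th a0 a x = 0 -> hugoniot_gap th a0 a y = 0 -> x = y.
Proof.
intros Hth H0 Ha Hx Hy Hax Hay.
destruct (Rtotal_order x y) as [Hlt | [| Hlt]]; [exfalso | assumption | exfalso].
- assert (Hneg := hugoniot_gap_neg_after_zero th a0 a x y Hth H0 Ha Hx Hlt Hax); lra.
- assert (Hneg := hugoniot_gap_neg_after_zero th a0 a y x Hth H0 Ha Hy Hlt Hay); lra.
Qed.

(** * Existence *)

Lemma exp_le_compat (x y : R) : x <= y -> exp x <= exp y.
Proof. intros [H | ->]; [apply Rlt_le, exp_increasing; exact H | apply Rle_refl]. Qed.

Lemma continuity_pt_of_ex_derive (f : R -> R) (x : R) : ex_derive f x -> continuity_pt f x.
Proof.
intros Hf; apply continuity_pt_filterlim.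
now apply (ex_derive_continuous f).
Qed.

(** For small [u] one has [p <= k u^3], so that the term [u^2 / p] is at least [1 / (k u)] and
    dominates; for large [u] one has [p >= k u^5 >= k u^3], which dominates [u^2]. *)
Lemma exists_temperature (th a0 a : R) :
  0 < th -> 0 < a0 < 1 -> 0 < a < 1 -> exists u, 0 < u /\ hugoniot_gap th a0 a u = 0.
Proof.
intros Hth H0 Ha.
pose proof (saha_ratio_pos a0 a H0 Ha) as Hk.
set (k := saha_ratio a0 a) in *.
set (B := 2 * (4 + k) + 2 * th).
set (C := 8 + 2 / k + 2 * th).
assert (Hik : 0 < 1 / k) by (apply Rdiv_lt_0_compat; lra).
assert (H2k : 2 / k = 2 * (1 / k)) by (field; lra).
assert (HB0 : 0 < B) by (unfold B; lra).
assert (HB : 0 < k * B) by (apply Rmult_lt_0_compat; lra).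
assert (HC : 0 < C / k) by (apply Rdiv_lt_0_compat; unfold C; lra).
(* [B] and [C] bound the competing terms, so that [1 / (k lo) > B] and [k hi > C]. *)
set (lo := / (1 + k * B)). set (hi := 1 + C / k).
assert (Hlo : 0 < lo) by (apply Rinv_0_lt_compat; lra).
assert (Hlo1 : lo < 1) by (unfold lo; rewrite <- Rinv_1; apply Rinv_lt_contravar; lra).
assert (Hhi : 1 < hi) by (unfold hi; lra).
assert (Hglo : 0 < hugoniot_gap th a0 a lo).
{ unfold hugoniot_gap.
  pose proof (pressure_ratio_pos th a0 a lo H0 Ha Hlo) as Hp.
  assert (Hlo2 : 0 < lo^2) by (now apply pow_lt).
  assert (Hexp : exp (th * (1 - 1 / lo^2)) <= 1).
  { apply Rle_trans with (exp 0); [apply exp_le_compat | rewrite exp_0; lra].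
    assert (1 <= 1 / lo^2).
    { replace 1 with (1 / 1) at 1 by field; apply Rmult_le_compat_l; [lra |].
      apply Rinv_le_contravar; nra. }
    rewrite <- (Rmult_0_r th); apply Rmult_le_compat_l; lra. }
  assert (Hpk3 : pressure_ratio th a0 a lo <= k * lo^3).
  { unfold pressure_ratio; fold k.
    assert (Hlo3 : 0 < lo^3) by (now apply pow_lt).
    assert (Hlo5 : 0 < lo^5) by (now apply pow_lt).
    assert (lo^5 <= lo^3).
    { replace (lo^5) with (lo^3 * lo^2) by ring; rewrite <- (Rmult_1_r (lo^3)) at 2.
      apply Rmult_le_compat_l; nra. }
    rewrite <- (Rmult_1_r (k * lo^3)).
    apply Rmult_le_compat; try assumption; [nra | apply Rlt_le, exp_pos |].
    apply Rmult_le_compat_l; lra. }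
  set (p := pressure_ratio th a0 a lo) in *; clearbody p.
  assert (Hip : 1 / (k * lo) <= lo^2 * (1 / p)).
  { apply Rmult_le_reg_r with (p * k * lo).
    - apply Rmult_lt_0_compat; [apply Rmult_lt_0_compat |]; lra.
    - replace (1 / (k * lo) * (p * k * lo)) with p by (field; lra).
      replace (lo^2 * (1 / p) * (p * k * lo)) with (k * lo^3) by (field; lra). lra. }
  assert (Hval : 1 / (k * lo) = 1 / k + B) by (unfold lo; field; lra).
  assert (Hpk : p <= k).
  { assert (lo^3 <= 1) by (rewrite <- (pow1 3); apply pow_incr; lra). nra. }
  assert (0 <= lo^2 * 4) by lra.
  assert ((1 + a) * lo^2 * (4 + 1 / p) >= 1 * (lo^2 * 4 + lo^2 * (1 / p))).
  { replace ((1 + a) * lo^2 * (4 + 1 / p)) with ((1 + a) * (lo^2 * 4 + lo^2 * (1 / p))) by ring.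
    apply Rle_ge, Rmult_le_compat_r; lra. }
  assert ((1 + a0) * (4 + p) <= 2 * (4 + k)) by (apply Rmult_le_compat; lra).
  assert (- th <= th * (a - a0)) by nra.
  unfold B in *; lra. }
assert (Hghi : hugoniot_gap th a0 a hi < 0).
{ unfold hugoniot_gap.
  assert (Hhi2 : 1 < hi^2) by (apply Rlt_pow_R1; [lra | lia]).
  assert (Hexp : 1 <= exp (th * (1 - 1 / hi^2))).
  { apply Rle_trans with (exp 0); [rewrite exp_0; lra | apply exp_le_compat].
    assert (1 / hi^2 <= 1).
    { replace 1 with (1 / 1) at 2 by field; apply Rmult_le_compat_l; [lra |].
      apply Rinv_le_contravar; lra. }
    apply Rmult_le_pos; lra. }
  assert (Hpk : k * hi^5 <= pressure_ratio th a0 a hi).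
  { unfold pressure_ratio; fold k.
    assert (0 < k * hi^5) by (apply Rmult_lt_0_compat; [lra | apply pow_lt; lra]).
    nra. }
  assert (Hp5 : k * hi^2 <= k * hi^5).
  { apply Rmult_le_compat_l; [lra |]. apply Rle_pow; [lra | lia]. }
  assert (Hp3 : k * hi^3 <= k * hi^5).
  { apply Rmult_le_compat_l; [lra |]. apply Rle_pow; [lra | lia]. }
  set (p := pressure_ratio th a0 a hi) in *; clearbody p.
  assert (Hp : 0 < p) by nra.
  assert (Hip : hi^2 * (1 / p) <= 1 / k).
  { apply Rmult_le_reg_r with (p * k); [nra |].
    replace (hi^2 * (1 / p) * (p * k)) with (k * hi^2) by (field; lra).
    replace (1 / k * (p * k)) with p by (field; lra). lra. }
  assert (Hkhi : k * hi = k + C) by (unfold hi; field; lra).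
  assert (Hk3 : k * hi^3 = (k + C) * hi^2) by (rewrite <- Hkhi; ring).
  assert ((1 + a) * hi^2 * (4 + 1 / p) <= 2 * (hi^2 * 4 + 1 / k)).
  { replace ((1 + a) * hi^2 * (4 + 1 / p)) with ((1 + a) * (hi^2 * 4 + hi^2 * (1 / p))) by ring.
    assert (0 < hi^2 * (1 / p)) by (apply Rmult_lt_0_compat; [lra | apply Rdiv_lt_0_compat; lra]).
    apply Rmult_le_compat; lra. }
  assert (1 * (4 + p) <= (1 + a0) * (4 + p)) by (apply Rmult_le_compat_r; lra).
  assert (th * (a - a0) <= th) by nra.
  assert (HCv : C = 8 + 2 * (1 / k) + 2 * th) by (unfold C; lra).
  assert ((C - 8) * 1 <= (C - 8) * hi^2) by (apply Rmult_le_compat_l; lra).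
  assert (0 < k * hi^2) by (apply Rmult_lt_0_compat; lra).
  lra. }
destruct (Ranalysis5.IVT_interv (fun u => - hugoniot_gap th a0 a u) lo hi) as [u [Hu Hz]]; try lra.
{ intros u Hu; apply continuity_pt_of_ex_derive.
  assert (Hp : 0 < pressure_ratio th a0 a u) by (apply pressure_ratio_pos; lra).
  unfold hugoniot_gap, pressure_ratio in *. auto_derive.
  repeat split; try apply Rgt_not_eq; try exact Hp; try nra. }
exists u; split; lra.
Qed.

(** At fixed [u] the pressure ratio takes every positive value as [a] varies, and the gap is
    negative when that value is large and positive when it is small. *)
Lemma exists_ionization (th a0 u : R) :
  0 < th -> 0 < a0 < 1 -> 0 < u -> exists a, 0 < a < 1 /\ hugoniot_gap th a0 a u = 0.
Proof.
intros Hth H0 Hu.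
set (K := a0^2 / (1 - a0^2) * u^5 * exp (th * (1 - 1 / u^2))).
assert (HK : 0 < K).
{ unfold K; apply Rmult_lt_0_compat; [apply Rmult_lt_0_compat | apply exp_pos].
  - apply Rdiv_lt_0_compat; nra.
  - now apply pow_lt. }
assert (Hu2 : 0 < u^2) by (now apply pow_lt).
assert (Hreach : forall m, 0 < m -> exists a, 0 < a < 1 /\ pressure_ratio th a0 a u = m).
{ intros m Hm.
  assert (Hr : 0 < K / (K + m) < 1).
  { split; [apply Rdiv_lt_0_compat; lra |].
    apply Rmult_lt_reg_r with (K + m); [lra |]. field_simplify; lra. }
  (* The solution of [K (1 - a^2) / a^2 = m]. *)
  exists (sqrt (K / (K + m))); split.
  - split; [now apply sqrt_lt_R0 |]. rewrite <- sqrt_1 at 1; apply sqrt_lt_1; lra.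
  - unfold pressure_ratio, saha_ratio.
    rewrite pow2_sqrt by lra.
    transitivity ((1 - K / (K + m)) / (K / (K + m)) * K); [unfold K; ring | field; lra]. }
set (M := 10 * u^2 + 2 * th).
set (N := (10 + 2 * th) / u^2).
assert (HM : 0 < M) by (unfold M; lra).
assert (HN : 0 < N) by (unfold N; apply Rdiv_lt_0_compat; lra).
destruct (Hreach (1 + M)) as [lo [Hlo Hplo]]; [lra |].
destruct (Hreach (/ (1 + N))) as [hi [Hhi Hphi]]; [apply Rinv_0_lt_compat; lra |].
assert (Hglo : hugoniot_gap th a0 lo u < 0).
{ unfold hugoniot_gap; rewrite Hplo.
  assert (Hi : 0 < 1 / (1 + M) < 1).
  { split; [apply Rdiv_lt_0_compat; lra |].
    apply Rmult_lt_reg_r with (1 + M); [lra |]. field_simplify; lra. }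
  assert ((1 + lo) * u^2 * (4 + 1 / (1 + M)) <= (2 * u^2) * 5)
    by (apply Rmult_le_compat; nra).
  assert (1 * (4 + (1 + M)) <= (1 + a0) * (4 + (1 + M))) by (apply Rmult_le_compat_r; lra).
  assert (th * (lo - a0) <= th) by nra.
  unfold M in *; lra. }
assert (Hghi : 0 < hugoniot_gap th a0 hi u).
{ unfold hugoniot_gap; rewrite Hphi.
  replace (1 / / (1 + N)) with (1 + N) by (field; lra).
  assert (Hi : 0 < / (1 + N) < 1).
  { split; [apply Rinv_0_lt_compat; lra |].
    rewrite <- Rinv_1; apply Rinv_lt_contravar; lra. }
  assert (HuN : u^2 * N = 10 + 2 * th) by (unfold N; field; lra).
  assert (u^2 * (4 + (1 + N)) <= (1 + hi) * u^2 * (4 + (1 + N)))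
    by (apply Rmult_le_compat_r; nra).
  assert ((1 + a0) * (4 + / (1 + N)) <= 2 * 5) by (apply Rmult_le_compat; lra).
  assert (- th <= th * (hi - a0)) by nra.
  nra. }
assert (Hlohi : lo < hi).
{ destruct (Rlt_le_dec lo hi) as [| [Hlt | Heq]]; [assumption | |].
  - pose proof (hugoniot_gap_incr th a0 hi lo u); lra.
  - subst; lra. }
destruct (Ranalysis5.IVT_interv (fun a => hugoniot_gap th a0 a u) lo hi) as [a [Ha Hz]]; try lra.
{ intros a Ha; apply continuity_pt_of_ex_derive.
  assert (Hp : 0 < pressure_ratio th a0 a u) by (apply pressure_ratio_pos; lra).
  unfold hugoniot_gap, pressure_ratio, saha_ratio in *. auto_derive.
  repeat split; try apply Rgt_not_eq; try exact Hp; try nra. }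
exists a; split; lra.
Qed.

(** * Back to the temperature *)

Lemma Rpower_five_halves (t : R) : 0 < t -> Rpower t (5 / 2) = sqrt t ^ 5.
Proof.
intros Ht.
rewrite <- (Rpower_pow 5) by (now apply sqrt_lt_R0).
rewrite <- Rpower_sqrt by assumption.
rewrite Rpower_mult; f_equal; simpl; field.
Qed.

Lemma hugoniot_eq_gap (Ti a0 T0 a u : R) :
  0 < T0 -> 0 < a0 < 1 -> 0 < a < 1 -> 0 < u ->
  hugoniot_eq Ti a0 T0 a (T0 * u^2) <-> hugoniot_gap (Ti / T0) a0 a u = 0.
Proof.
intros HT0 H0 Ha Hu.
assert (Hu2 : 0 < u^2) by (now apply pow_lt).
assert (Hu5 : 0 < u^5) by (now apply pow_lt).
unfold hugoniot_eq.
replace (T0 * u^2 / T0) with (u^2) by (field; lra).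
replace (T0 / (T0 * u^2)) with ((/ u)^2) by (field; lra).
rewrite !Rpower_five_halves by (try assumption; apply pow_lt, Rinv_0_lt_compat; lra).
rewrite !sqrt_pow2 by (try apply Rlt_le, Rinv_0_lt_compat; lra).
set (E := exp (Ti / T0 * (1 - 1 / u^2))).
assert (HE : 0 < E) by apply exp_pos.
replace (exp (- Ti / (T0 * u^2) + Ti / T0)) with E by (unfold E; f_equal; field; lra).
replace (exp (- Ti / T0 + Ti / (T0 * u^2))) with (/ E)
  by (unfold E; rewrite <- exp_Ropp; f_equal; field; lra).
unfold hugoniot_gap, pressure_ratio, saha_ratio; fold E.
match goal with |- ?l = ?r <-> ?g = 0 => assert (Heq : l - r = T0 * g) end.
{ field; repeat split; nra. }
split; intros H.
- apply Rmult_eq_reg_l with T0; lra.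
- rewrite H in Heq; lra.
Qed.

Lemma thermo_hugoniot_locus_gap (Ti a0 T0 a T : R) :
  0 < T0 -> 0 < a0 < 1 ->
  thermo_hugoniot_locus Ti a0 T0 a T
  <-> 0 < a < 1 /\ 0 < T /\ hugoniot_gap (Ti / T0) a0 a (sqrt (T / T0)) = 0.
Proof.
intros HT0 H0; unfold thermo_hugoniot_locus.
split; intros (Ha & HT & H); repeat split; try lra;
  assert (Hq : 0 < T / T0) by (now apply Rdiv_lt_0_compat);
  assert (Heq : T = T0 * sqrt (T / T0) ^ 2) by (rewrite pow2_sqrt by lra; field; lra).
- apply hugoniot_eq_gap; auto using sqrt_lt_R0; now rewrite <- Heq.
- rewrite Heq; apply hugoniot_eq_gap; auto using sqrt_lt_R0.
Qed.

Theorem proposition5p2 (Ti alpha0 T0 : R) (hTi : 0 < Ti)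
    (halpha0 : 0 < alpha0 < 1) (hT0 : 0 < T0) :
  exists Tf : R -> R,
    (forall alpha T : R,
        thermo_hugoniot_locus Ti alpha0 T0 alpha T
        <-> (0 < alpha < 1 /\ T = Tf alpha)) /\
    (forall alpha beta : R,
        0 < alpha -> alpha < beta -> beta < 1 -> Tf alpha < Tf beta) /\
    filterlim Tf (at_right 0) (locally 0) /\
    filterlim Tf (at_left 1) (Rbar_locally p_infty).
Proof.
assert (Hth : 0 < Ti / T0) by (now apply Rdiv_lt_0_compat).
assert (Hsqrt : forall T, 0 < T -> 0 < sqrt (T / T0))
  by (intros T HT; now apply sqrt_lt_R0, Rdiv_lt_0_compat).
set (Tf := fun a => epsilon (inhabits 0) (thermo_hugoniot_locus Ti alpha0 T0 a)).
assert (Hspec : forall a, 0 < a < 1 -> thermo_hugoniot_locus Ti alpha0 T0 a (Tf a)).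
{ intros a Ha; apply epsilon_spec.
  destruct (exists_temperature (Ti / T0) alpha0 a) as [u [Hu Hz]]; auto.
  exists (T0 * u^2).
  assert (0 < T0 * u^2) by (apply Rmult_lt_0_compat; [lra | now apply pow_lt]).
  repeat split; try lra.
  now apply hugoniot_eq_gap. }
assert (Huniq : forall a T, thermo_hugoniot_locus Ti alpha0 T0 a T -> T = Tf a).
{ intros a T HaT.
  pose proof (Hspec a (proj1 HaT)) as HaTf.
  apply thermo_hugoniot_locus_gap in HaT as (Ha & HT & Hz); auto.
  apply thermo_hugoniot_locus_gap in HaTf as (_ & HTf & Hzf); auto.
  assert (Hs : sqrt (T / T0) = sqrt (Tf a / T0))
    by (apply (hugoniot_zero_unique (Ti / T0) alpha0 a); auto).
  apply sqrt_inj in Hs; try (apply Rlt_le, Rdiv_lt_0_compat; lra).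
  apply Rmult_eq_reg_r with (/ T0); [exact Hs | apply Rinv_neq_0_compat; lra]. }
assert (Hincr : forall a b, 0 < a -> a < b -> b < 1 -> Tf a < Tf b).
{ intros a b Ha Hab Hb.
  destruct (proj1 (thermo_hugoniot_locus_gap _ _ _ _ _ hT0 halpha0) (Hspec a ltac:(lra)))
    as (_ & HTa & Hza).
  destruct (proj1 (thermo_hugoniot_locus_gap _ _ _ _ _ hT0 halpha0) (Hspec b ltac:(lra)))
    as (_ & HTb & Hzb).
  assert (Hs : sqrt (Tf a / T0) < sqrt (Tf b / T0))
    by (apply (hugoniot_zero_order (Ti / T0) alpha0 a b); auto; lra).
  apply sqrt_lt_0_alt in Hs.
  apply Rmult_lt_reg_r with (/ T0); [now apply Rinv_0_lt_compat | exact Hs]. }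
assert (Hsurj : forall T, 0 < T -> exists a, 0 < a < 1 /\ Tf a = T).
{ intros T HT.
  destruct (exists_ionization (Ti / T0) alpha0 (sqrt (T / T0))) as [a [Ha Hz]]; auto.
  exists a; split; [assumption |].
  symmetry; apply Huniq, thermo_hugoniot_locus_gap; auto. }
exists Tf; split; [| split; [assumption | split]].
- intros a T; split.
  + intros H; split; [exact (proj1 H) | auto].
  + intros [Ha ->]; auto.
(* The threshold for [eps] is the ionization degree at which [Tf] equals [eps]. *)
- apply filterlim_locally; intros eps.
  destruct (Hsurj eps (cond_pos eps)) as [d [Hd HTd]].
  exists (mkposreal d (proj1 Hd)); simpl; intros a Hball Ha.
  apply Rabs_def2 in Hball.
  unfold minus, plus, opp in Hball; simpl in Hball.
  assert (Hpos : 0 < Tf a) by (apply (Hspec a); lra).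
  assert (Tf a < eps) by (rewrite <- HTd; apply Hincr; lra).
  apply Rabs_def1; unfold minus, plus, opp; simpl; lra.
(* The maximum with 1 makes the level positive, so that it is a value of [Tf]. *)
- intros P [M HM].
  destruct (Hsurj (Rmax M 1)) as [d [Hd HTd]].
  { pose proof (Rmax_r M 1); lra. }
  exists (mkposreal (1 - d) ltac:(lra)); simpl; intros a Hball Ha.
  apply Rabs_def2 in Hball.
  unfold minus, plus, opp in Hball; simpl in Hball.
  apply HM.
  apply Rle_lt_trans with (Tf d); [rewrite HTd; apply Rmax_l | apply Hincr; lra].
Qed.
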